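(* Let $\alpha\ge 0$ and $\gamma\ge 1$ be real numbers and let $\beta\in\mathbb{C}$ satisfy $2(\gamma+\alpha)\ge 3|\beta|$. Then for every integer $m\ge 0$ and every $z\in\mathfrak{U}$, $$\operatorname{Re}\left\{\frac{\mathbb{R}_{\alpha,\beta,\gamma}(z)}{(\mathbb{R}_{\alpha,\beta,\gamma})_m(z)}\right\}\ge \frac{2(\gamma+\alpha)-3|\beta|}{2(\gamma+\alpha)-|\beta|}$$ and $$\operatorname{Re}\left\{\frac{(\mathbb{R}_{\alpha,\beta,\gamma})_m(z)}{\mathbb{R}_{\alpha,\beta,\gamma}(z)}\right\}\ge \frac{2(\gamma+\alpha)-|\beta|}{2(\gamma+\alpha)+|\beta|}.$$
   Context: $\mathfrak{U}=\{z\in\mathbb{C}:|z|<1\}$ is the open unit disc. For real $\alpha\ge 0$, $\gamma\ge 1$ and $\beta\in\mathbb{C}$, the normalized (generalized) Rabotnov function is $$\mathbb{R}_{\alpha,\beta,\gamma}(z)=z+\sum_{n=1}^{\infty}A_n z^{n+1},\qquad A_n=\frac{\beta^n\,\Gamma(\gamma+\alpha)}{\Gamma((\gamma+\alpha)(n+1))},\qquad z\in\mathfrak{U},$$ where $\Gamma$ is the Gamma function. Its partial sums are $(\mathbb{R}_{\alpha,\beta,\gamma})_m(z)=z+\sum_{n=1}^{m}A_n z^{n+1}$ for $m\in\{1,2,3,\dots\}$ and $(\mathbb{R}_{\alpha,\beta,\gamma})_0(z)=z$. At $z=0$ the quotients are understood by removing the common factor $z$ from numerator and denominator (removable singularity).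 *)

(* Defs.v *)
From Stdlib Require Import Reals.
From Coquelicot Require Import Coquelicot.
Local Open Scope R_scope.

(** Euler's integral, improper at both ends; only its values at [x > 0] are
    meaningful. *)
Definition Gamma (x : R) : R :=
  RInt_gen (fun t : R => Rpower t (x - 1) * exp (- t))
           (at_right 0) (Rbar_locally p_infty).

(** Sum of a complex series (Coquelicot's [Series] is real-valued): the [l] with
    [is_series a l], unspecified if the series diverges. *)
Definition CSeries (a : nat -> C) : C :=
  iota (T := C_CompleteNormedModule)
       (fun l : C => is_series (K := C_AbsRing) (V := C_NormedModule) a l).

Definition Rabotnov_coeff (alpha gamma : R) (beta : C) (n : nat) : C :=
  (Cpow beta n
   * RtoC (Gamma (gamma + alpha) / Gamma ((gamma + alpha) * (INR n + 1))))%C.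

(** The sum over [n >= 1] is reindexed to start at [0]. *)
Definition Rabotnov (alpha gamma : R) (beta : C) (z : C) : C :=
  (z + CSeries (fun n => Rabotnov_coeff alpha gamma beta (S n)
                         * Cpow z (S n + 1)))%C.

(** For [m = 0] the sum [sum_n_m _ 1 0] is empty. *)
Definition Rabotnov_partial (alpha gamma : R) (beta : C) (m : nat) (z : C) : C :=
  (z + sum_n_m (G := C_AbelianMonoid)
         (fun n => Rabotnov_coeff alpha gamma beta n * Cpow z (n + 1)) 1 m)%C.

(** The two functions above with the common factor [z] removed. *)
Definition Rabotnov_red (alpha gamma : R) (beta : C) (z : C) : C :=
  (1 + CSeries (fun n => Rabotnov_coeff alpha gamma beta (S n)
                         * Cpow z (S n)))%C.

Definition Rabotnov_partial_red
    (alpha gamma : R) (beta : C) (m : nat) (z : C) : C :=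
  (1 + sum_n_m (G := C_AbelianMonoid)
         (fun n => Rabotnov_coeff alpha gamma beta n * Cpow z n) 1 m)%C.

(** The literal quotients would be [0 / 0] at [z = 0]; there the common factor
    [z] is cancelled first. *)
Definition Rabotnov_quot (alpha gamma : R) (beta : C) (m : nat) (z : C) : C :=
  if Ceq_dec z 0
  then (Rabotnov_red alpha gamma beta z
        / Rabotnov_partial_red alpha gamma beta m z)%C
  else (Rabotnov alpha gamma beta z / Rabotnov_partial alpha gamma beta m z)%C.

Definition Rabotnov_quot_inv (alpha gamma : R) (beta : C) (m : nat) (z : C) : C :=
  if Ceq_dec z 0
  then (Rabotnov_partial_red alpha gamma beta m z
        / Rabotnov_red alpha gamma beta z)%C
  else (Rabotnov_partial alpha gamma beta m z / Rabotnov alpha gamma beta z)%C.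

(* Main.v *)
Require Import Defs.
From Stdlib Require Import Reals Lra Lia.
From Coquelicot Require Import Coquelicot.
Local Open Scope R_scope.

(** For [1 <= c <= d] one has [t^d - t^c >= (d - c)(t - 1)], and [(t - 1) exp (-t)]
    integrates to [Gamma 2 - Gamma 1 = 0], so [Gamma] is nondecreasing on
    [[2, +oo)]. With [s = gamma + alpha] this gives
    [Gamma (s(n+1)) >= Gamma (sn + 1) = sn Gamma (sn)], and by induction the
    coefficients satisfy [|A_n| <= 2 q^n] where [q = |beta| / (2s) <= 1/3]. Hence
    with [k = 2q / (1-q) <= 1] the reduced partial sum [p] and the tail [t] obey
    [|p - 1| <= |z| k (1 - q^m)] and [|t| <= |z| k q^m], so [|t/p| <= k], and
    [Re (1 + w) >= 1 - k], [Re (1 / (1 + w)) >= 1 / (1 + k)] on the disc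
    [|w| <= k]. *)

(** * Convergence and positivity of Euler's integral on [[1, +oo)] *)

Lemma exp_nondecreasing (x y : R) : x <= y -> exp x <= exp y.
Proof. intros [H | ->]; [now apply Rlt_le, exp_increasing | apply Rle_refl]. Qed.

Local Instance at_right_proper (x : R) : ProperFilter' (at_right x).
Proof. apply Proper_StrongProper. apply at_right_proper_filter. Qed.

(** For a nonnegative integrand the integrals over [[a, b]] grow with the interval, so the improper
    integral is their supremum. The second conjunct later yields positivity of [Gamma]. *)
Lemma is_RInt_gen_nonneg_bounded (f : R -> R) (M : R) :
  (forall t, 0 < t -> 0 <= f t) ->
  (forall t, 0 < t -> continuous f t) ->
  (forall a b, 0 < a <= b -> RInt f a b <= M) ->
  exists L, is_RInt_gen f (at_right 0) (Rbar_locally p_infty) L /\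
    forall a b, 0 < a <= b -> RInt f a b <= L.
Proof.
  intros Hpos Hcont HM.
  assert (Hex : forall a b, 0 < a <= b -> ex_RInt f a b).
  { intros a b Hab. apply (ex_RInt_continuous (V := R_CompleteNormedModule)). intros t Ht.
    apply Hcont. rewrite Rmin_left in Ht; lra. }
  destruct (completeness (fun y => exists a b, 0 < a <= b /\ y = RInt f a b))
    as [L [Hub Hlub]].
  - exists M. intros y (a & b & Hab & ->). now apply HM.
  - exists (RInt f 1 1), 1, 1. split; [lra | reflexivity].
  - assert (HL : forall a b, 0 < a <= b -> RInt f a b <= L).
    { intros a b Hab. apply Hub. now exists a, b. }
    exists L. split; [| exact HL].
    intros P [eps Heps].
    assert (exists a b, 0 < a <= b /\ L - eps < RInt f a b) as (a0 & b0 & H0 & Hlt).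
    { destruct (Classical_Prop.classic
        (exists a b, 0 < a <= b /\ L - eps < RInt f a b)) as [E | N]; [exact E |].
      exfalso. assert (L <= L - eps); [| destruct eps; simpl in *; lra].
      apply Hlub. intros y (a & b & Hab & ->).
      apply Rnot_lt_le. intros Hl. apply N. now exists a, b. }
    (* Any such interval contains [[a0, b0]], so its integral lies between [L - eps] and [L]. *)
    exists (fun a => 0 < a < a0) (fun b => b0 < b).
    + exists (mkposreal a0 (proj1 H0)). intros y Hy Hy0. split; [exact Hy0 |].
      apply Rabs_lt_between' in Hy. simpl in Hy. lra.
    + now exists b0.
    + intros a b Ha Hb. exists (RInt f a b). split.
      * apply (RInt_correct (V := R_CompleteNormedModule)). apply Hex. lra.
      * apply Heps. apply Rabs_lt_between'.
        assert (Hab : RInt f a b <= L) by (apply HL; lra).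
        assert (E : RInt f a b = RInt f a a0 + RInt f a0 b0 + RInt f b0 b).
        { rewrite <- (RInt_Chasles f a b0 b), <- (RInt_Chasles f a a0 b0);
            try (apply Hex; lra). reflexivity. }
        assert (0 <= RInt f a a0) by
          (apply RInt_ge_0; [lra | apply Hex; lra | intros; apply Hpos; lra]).
        assert (0 <= RInt f b0 b) by
          (apply RInt_ge_0; [lra | apply Hex; lra | intros; apply Hpos; lra]).
        assert (0 < eps) by (destruct eps; assumption).
        lra.
Qed.

Definition gamma_integrand (x t : R) : R := Rpower t (x - 1) * exp (- t).

Lemma gamma_integrand_pos (x t : R) : 0 < gamma_integrand x t.
Proof. apply Rmult_lt_0_compat; apply exp_pos. Qed.

(** Integrated over [(0, +oo)], this is the integration by parts behind the functional equation. It
    also supplies continuity of the integrand. *)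
Lemma is_derive_gamma_integrand (x t : R) : 0 < t ->
  is_derive (gamma_integrand (x + 1)) t
    (x * gamma_integrand x t - gamma_integrand (x + 1) t).
Proof.
  intros Ht. unfold gamma_integrand, Rpower.
  auto_derive; [exact Ht |].
  replace (x + 1 - 1) with x by ring.
  replace (x * ln t) with ((x - 1) * ln t + ln t) by ring.
  rewrite exp_plus, exp_ln by exact Ht. field. lra.
Qed.

Lemma continuous_gamma_integrand (x t : R) : 0 < t ->
  continuous (gamma_integrand x) t.
Proof.
  intros Ht. replace x with (x - 1 + 1) by ring.
  apply (ex_derive_continuous (V := R_NormedModule)). eexists.
  now apply is_derive_gamma_integrand.
Qed.

(** The tangent to [ln] at [k = 2x] gives [ln t <= t/k - 1 + ln k]. Since [(x - 1)/k <= 1/2], the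
    power costs at most half of the exponential decay. *)
Lemma gamma_integrand_le_exp (x : R) : 1 <= x ->
  exists C, 0 < C /\ forall t, 0 < t -> gamma_integrand x t <= C * exp (- t / 2).
Proof.
  intros Hx. set (k := 2 * x).
  exists (exp ((x - 1) * ln k)). split; [apply exp_pos |].
  intros t Ht. unfold gamma_integrand, Rpower. rewrite <- !exp_plus.
  assert (Hln : ln t <= t / k - 1 + ln k).
  { replace t with (t / k * k) at 1 by (unfold k; field; lra).
    assert (0 < t / k) by (apply Rdiv_lt_0_compat; unfold k; lra).
    rewrite ln_mult by (unfold k in *; lra).
    pose proof (exp_ineq1_le (ln (t / k))) as H1. rewrite exp_ln in H1; lra. }
  assert (Hk : (x - 1) * (t / k) <= t / 2).
  { replace (t / 2) with (x * (t / k)) by (unfold k; field; lra).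
    apply Rmult_le_compat_r; [| lra].
    apply Rlt_le, Rdiv_lt_0_compat; unfold k; lra. }
  apply exp_nondecreasing. assert ((x - 1) * ln t <= (x - 1) * (t / k - 1 + ln k)) by
    (apply Rmult_le_compat_l; lra). lra.
Qed.

Lemma is_RInt_gen_Gamma (x : R) : 1 <= x ->
  is_RInt_gen (gamma_integrand x) (at_right 0) (Rbar_locally p_infty) (Gamma x)
  /\ 0 < Gamma x.
Proof.
  intros Hx. destruct (gamma_integrand_le_exp x Hx) as (C & HC & Hbound).
  (* The bound [2 * C] is the integral of [C * exp (- t / 2)] over [(0, +oo)]. *)
  destruct (is_RInt_gen_nonneg_bounded (gamma_integrand x) (2 * C)) as (L & HL & Hle).
  - intros t _. apply Rlt_le, gamma_integrand_pos.
  - apply continuous_gamma_integrand.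
  - intros a b Hab.
    assert (HI : is_RInt (fun t => C * exp (- t / 2)) a b
              (minus (- 2 * C * exp (- b / 2)) (- 2 * C * exp (- a / 2)))).
    { apply (is_RInt_derive (fun t => - 2 * C * exp (- t / 2))).
      - intros t _. auto_derive; [exact I |]. unfold Rdiv. field.
      - intros t _. apply (ex_derive_continuous (V := R_NormedModule)).
        auto_derive. exact I. }
    apply Rle_trans with (RInt (fun t => C * exp (- t / 2)) a b).
    + apply RInt_le; [lra | | eexists; exact HI |].
      * apply (ex_RInt_continuous (V := R_CompleteNormedModule)).
        intros t Ht. rewrite Rmin_left in Ht by lra.
        apply continuous_gamma_integrand. lra.
      * intros t Ht. apply Hbound. lra.
    + rewrite (is_RInt_unique _ _ _ _ HI). unfold minus, plus, opp; simpl.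
      assert (exp (- a / 2) < 1) by (rewrite <- exp_0; apply exp_increasing; lra).
      pose proof (exp_pos (- b / 2)). nra.
  - assert (Gamma x = L) as -> by
      exact (is_RInt_gen_unique (V := R_CompleteNormedModule) _ _ HL).
    split; [exact HL |].
    apply Rlt_le_trans with (RInt (gamma_integrand x) 1 2); [| apply Hle; lra].
    apply RInt_gt_0; [lra | intros; apply gamma_integrand_pos |].
    intros t Ht. apply continuous_gamma_integrand. lra.
Qed.

(** * Boundary terms and the functional equation of [Gamma] *)

Lemma gamma_integrand_lim_at_right_0 (x : R) : 1 <= x ->
  filterlim (gamma_integrand (x + 1)) (at_right 0) (locally 0).
Proof.
  intros Hx P [eps Heps].
  assert (He : 0 < Rmin 1 eps) by (apply Rmin_pos; [lra | apply cond_pos]).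
  exists (mkposreal _ He). intros t Ht Ht0. apply Heps.
  apply Rabs_lt_between' in Ht. simpl in Ht.
  pose proof (Rmin_l 1 eps). pose proof (Rmin_r 1 eps).
  apply Rabs_lt_between'. pose proof (gamma_integrand_pos (x + 1) t).
  (* For [0 < t < 1] and [x >= 1], both [t^x <= t] and [exp (- t) <= 1]. *)
  enough (gamma_integrand (x + 1) t <= t) by lra.
  unfold gamma_integrand, Rpower. rewrite <- exp_plus.
  rewrite <- (exp_ln t) at 3 by exact Ht0. apply exp_nondecreasing.
  assert (ln t < 0) by (rewrite <- ln_1; apply ln_increasing; lra). nra.
Qed.

Lemma gamma_integrand_lim_p_infty (x : R) : 1 <= x ->
  filterlim (gamma_integrand x) (Rbar_locally p_infty) (locally 0).
Proof.
  intros Hx. destruct (gamma_integrand_le_exp x Hx) as (C & HC & Hbound).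
  apply (filterlim_le_le (fun _ => 0) (gamma_integrand x)
           (fun t => C * exp (- t / 2)) 0).
  - exists 0. intros t Ht. split; [apply Rlt_le, gamma_integrand_pos | auto].
  - apply filterlim_const.
  - change (is_lim (fun t => C * exp (- t / 2)) p_infty 0).
    replace (Finite 0) with (Rbar_mult C 0) by (simpl; f_equal; ring).
    apply is_lim_scal_l. apply (is_lim_comp exp (fun t => - t / 2) p_infty 0 m_infty).
    + apply is_lim_exp_m.
    + apply (is_lim_ext (fun t => (- / 2) * t)); [intros; field |].
      replace m_infty with (Rbar_mult (- / 2) p_infty).
      * apply is_lim_scal_l, is_lim_id.
      * simpl. case Rle_dec; intros; [exfalso; lra | reflexivity].
    + now exists 0.
Qed.

Lemma Gamma_succ (x : R) : 1 <= x -> Gamma (x + 1) = x * Gamma x.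
Proof.
  intros Hx.
  destruct (is_RInt_gen_Gamma x Hx) as [H0 _].
  destruct (is_RInt_gen_Gamma (x + 1)) as [H1 _]; [lra |].
  pose proof (is_RInt_gen_minus (V := R_NormedModule) _ _ _ _
    (is_RInt_gen_scal (V := R_NormedModule) _ x _ H0) H1) as H.
  (* The two zeros are the limits of [t^x exp (- t)] at [+oo] and at [0]. *)
  assert (HD : is_RInt_gen (Derive (gamma_integrand (x + 1)))
                 (at_right 0) (Rbar_locally p_infty) (0 - 0)).
  { apply is_RInt_gen_Derive.
    - exists (fun a => 0 < a) (fun b => 0 < b);
        [exists (mkposreal _ Rlt_0_1); auto | exists 0; auto |].
      intros a b Ha Hb t [Ht _]. eexists. apply is_derive_gamma_integrand.
      eapply Rlt_le_trans; [| exact Ht]. now apply Rmin_glb_lt.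
    - exists (fun a => 0 < a) (fun b => 0 < b);
        [exists (mkposreal _ Rlt_0_1); auto | exists 0; auto |].
      intros a b Ha Hb t [Ht _].
      assert (Ht0 : 0 < t) by
        (eapply Rlt_le_trans; [| exact Ht]; now apply Rmin_glb_lt).
      apply (continuous_ext_loc (T := R_UniformSpace) (U := R_UniformSpace) _
        (fun t => x * gamma_integrand x t - gamma_integrand (x + 1) t)).
      + apply (filter_imp (fun u => 0 < u)); [| now apply open_gt].
        intros u Hu. symmetry. now apply is_derive_unique, is_derive_gamma_integrand.
      + apply (continuous_minus (V := R_NormedModule)).
        * apply (continuous_scal_r (V := R_NormedModule)).
          now apply continuous_gamma_integrand.
        * now apply continuous_gamma_integrand.
    - now apply gamma_integrand_lim_at_right_0.
    - apply gamma_integrand_lim_p_infty. lra. }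
  apply (is_RInt_gen_ext (V := R_NormedModule) _ (fun t => minus (scal x (gamma_integrand x t))
    (gamma_integrand (x + 1) t))) in HD.
  - apply (is_RInt_gen_unique (V := R_CompleteNormedModule)) in HD.
    apply (is_RInt_gen_unique (V := R_CompleteNormedModule)) in H.
    pose proof (eq_trans (eq_sym H) HD) as E.
    unfold minus, plus, opp, scal in E; simpl in E.
    unfold mult in E; simpl in E. lra.
  - exists (fun a => 0 < a) (fun b => 0 < b);
      [exists (mkposreal _ Rlt_0_1); auto | exists 0; auto |].
    intros a b Ha Hb t [Ht _]. apply is_derive_unique.
    apply is_derive_gamma_integrand.
    eapply Rlt_trans; [| exact Ht]. now apply Rmin_glb_lt.
Qed.

(** * Monotonicity of [Gamma] on [[2, +oo)] *)

Lemma Gamma_incr (x y : R) : 2 <= x <= y -> Gamma x <= Gamma y.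
Proof.
  intros [Hx Hxy].
  destruct (is_RInt_gen_Gamma 1) as [I1 _]; [lra |].
  destruct (is_RInt_gen_Gamma 2) as [I2 _]; [lra |].
  destruct (is_RInt_gen_Gamma x) as [Ix Px]; [lra |].
  destruct (is_RInt_gen_Gamma y) as [Iy _]; [lra |].
  (* The integrand here is [(t^(y-1) - (y-x)(t-1)) exp (- t)]; as [Gamma 2 = Gamma 1], its integral
     is [Gamma y]. *)
  pose proof (is_RInt_gen_minus (V := R_NormedModule) _ _ _ _ Iy
    (is_RInt_gen_scal (V := R_NormedModule) _ (y - x) _
      (is_RInt_gen_minus (V := R_NormedModule) _ _ _ _ I2 I1))) as H.
  assert (E : Gamma 2 = Gamma 1).
  { replace 2 with (1 + 1) by ring. rewrite Gamma_succ by lra. ring. }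
  (* The norm inequality serves as a comparison theorem, the smaller integrand being positive. Its
     first side condition, ordered endpoints, is met by separating them at [1]. *)
  unshelve epose proof (RInt_gen_norm (V := R_CompleteNormedModule) _ _ _ _ _ _ Ix H) as HN.
  - exists (fun a => 0 < a < 1) (fun b => 1 < b);
      [ | exists 1; auto | simpl; intros; lra].
    exists (mkposreal _ Rlt_0_1). intros t Ht Ht0.
    apply Rabs_lt_between' in Ht. simpl in Ht. lra.
  - exists (fun a => 0 < a) (fun b => 0 < b);
      [exists (mkposreal _ Rlt_0_1); auto | exists 0; auto |].
    intros a b Ha Hb t [Ht _]. simpl in Ht. assert (Ht0 : 0 < t) by lra.
    unfold norm, minus, plus, opp, scal; simpl. unfold abs, mult; simpl.
    rewrite Rabs_pos_eq by apply Rlt_le, gamma_integrand_pos.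
    unfold gamma_integrand.
    replace (2 - 1) with 1 by ring. replace (1 - 1) with 0 by ring.
    rewrite Rpower_1, Rpower_O by exact Ht0.
    (* [t^(y-1) - t^(x-1) >= (y-x) t^(x-1) ln t >= (y-x) t ln t >= (y-x)(t-1)] *)
    assert (H1 : Rpower t (x - 1) * (1 + (y - x) * ln t) <= Rpower t (y - 1)).
    { unfold Rpower. replace ((y - 1) * ln t) with ((x - 1) * ln t + (y - x) * ln t) by ring.
      rewrite exp_plus. apply Rmult_le_compat_l; [apply Rlt_le, exp_pos |].
      apply exp_ineq1_le. }
    (* Since [x >= 2], the difference [t^(x-1) - t] has the sign of [ln t], so the product is
       nonnegative on both sides of [t = 1]. *)
    assert (H2 : t * ln t <= Rpower t (x - 1) * ln t).
    { unfold Rpower. rewrite <- (exp_ln t) at 1 by exact Ht0.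
      destruct (Rle_dec 0 (ln t)) as [Hl | Hl].
      - apply Rmult_le_compat_r; [exact Hl |]. apply exp_nondecreasing. nra.
      - rewrite !(Rmult_comm _ (ln t)). apply Rmult_le_compat_neg_l; [lra |]. apply exp_nondecreasing. nra. }
    assert (H3 : t - 1 <= t * ln t).
    { pose proof (exp_ineq1_le (- ln t)) as E1. rewrite exp_Ropp, exp_ln in E1 by exact Ht0.
      apply (Rmult_le_compat_l t) in E1; [| lra]. rewrite Rinv_r in E1; lra. }
    assert (H4 : (y - x) * (t - 1) <= (y - x) * (Rpower t (x - 1) * ln t)) by
      (apply Rmult_le_compat_l; lra).
    pose proof (exp_pos (- t)).
    assert (Rpower t (x - 1) <= Rpower t (y - 1) - (y - x) * (t - 1)) by lra.
    nra.
  - unfold norm, minus, plus, opp, scal in HN; simpl in HN.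
    unfold abs, mult in HN; simpl in HN. rewrite E in HN.
    rewrite Rabs_pos_eq in HN; lra.
Qed.

(** * Complex series dominated by a geometric series *)

(** The right side is the closed form of the sum of [r * 2 q^n] over [m < n <= N]. It serves the
    partial sum (from [m = 0]) as well as the tail (as [N] grows). *)
Lemma Cmod_sum_le_geometric (a : nat -> C) (r q : R) (m N : nat) :
  (forall n, (1 <= n)%nat -> Cmod (a n) <= r * (2 * q ^ n)) -> q < 1 ->
  (m <= N)%nat ->
  Cmod (sum_n_m (G := C_AbelianMonoid) a (S m) N)
    <= r * (2 * q / (1 - q)) * (q ^ m - q ^ N).
Proof.
  intros Ha Hq Hm. induction Hm as [| N Hm IH].
  - rewrite (sum_n_m_zero (G := C_AbelianMonoid)) by lia.
    change (Cmod (RtoC 0) <= r * (2 * q / (1 - q)) * (q ^ m - q ^ m)).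
    rewrite Cmod_0. lra.
  - rewrite (sum_n_Sm (G := C_AbelianMonoid)) by lia.
    eapply Rle_trans; [apply Cmod_triangle |].
    eapply Rle_trans; [apply Rplus_le_compat; [exact IH | apply Ha; lia] |].
    apply Req_le. simpl. field. lra.
Qed.

(** The finite bound holds for every stage [N >= m]; the modulus is continuous, so it passes to the
    limit. *)
Lemma C_is_series_tail_le (a : nat -> C) (r q : R) (m : nat) (l : C) :
  (forall n, (1 <= n)%nat -> Cmod (a n) <= r * (2 * q ^ n)) ->
  0 <= r -> 0 <= q < 1 ->
  is_series (K := C_AbsRing) (V := C_NormedModule) (fun n => a (S n)) l ->
  Cmod (l - sum_n_m (G := C_AbelianMonoid) a 1 m)
    <= r * (2 * q / (1 - q)) * q ^ m.
Proof.
  intros Ha Hr Hq Hl.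
  set (P := sum_n_m (G := C_AbelianMonoid) a 1 m).
  assert (Hlim : filterlim (fun N => norm (minus (sum_n (fun n => a (S n)) N) P : C_NormedModule))
            eventually (locally (norm (minus l P : C_NormedModule)))).
  { eapply filterlim_comp; [| apply filterlim_norm].
    refine (filterlim_comp_2 (V := C_NormedModule) (sum_n (fun n => a (S n)))
              (fun _ => opp P) plus Hl (filterlim_const _)
              (filterlim_plus (V := C_NormedModule) _ _)). }
  change (is_lim_seq (fun N => Cmod (sum_n (fun n => a (S n)) N - P)) (Cmod (l - P)))
    in Hlim.
  change (Rbar_le (Cmod (l - P)) (r * (2 * q / (1 - q)) * q ^ m)).
  refine (is_lim_seq_le_loc _ _ _ _ _ Hlim (is_lim_seq_const _)).
  exists m. intros N HN. change (Cmod (sum_n (fun n => a (S n)) N - P)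
    <= r * (2 * q / (1 - q)) * q ^ m).
  (* The series is shifted by one, so its partial sum up to [N] runs over [a 1], ..., [a (S N)]. *)
  assert (E : sum_n (fun n => a (S n)) N =
    (P + sum_n_m (G := C_AbelianMonoid) a (S m) (S N))%C).
  { unfold sum_n. rewrite (sum_n_m_S (G := C_AbelianMonoid)).
    apply (sum_n_m_Chasles (G := C_AbelianMonoid)); lia. }
  assert (F : forall u v : C, (u + v - u)%C = v) by (intros; ring).
  rewrite E, F.
  eapply Rle_trans; [apply (Cmod_sum_le_geometric a r q); [exact Ha | lra | lia] |].
  apply Rmult_le_compat_l.
  - apply Rmult_le_pos; [exact Hr |]. apply Rdiv_le_0_compat; lra.
  - assert (0 <= q ^ S N) by (apply pow_le; lra). lra.
Qed.

Lemma C_ex_series_geometric (a : nat -> C) (r q : R) :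
  (forall n, (1 <= n)%nat -> Cmod (a n) <= r * (2 * q ^ n)) -> 0 <= q < 1 ->
  exists l : C, is_series (K := C_AbsRing) (V := C_NormedModule) (fun n => a (S n)) l.
Proof.
  intros Ha Hq.
  apply (ex_series_le (V := C_CompleteNormedModule) _ (fun n => (r * 2 * q) * q ^ n)).
  - intros n. eapply Rle_trans; [apply Ha; lia |]. apply Req_le. simpl. ring.
  - apply (ex_series_scal (V := R_NormedModule)). exists (/ (1 - q)).
    apply is_series_geom. rewrite Rabs_pos_eq; lra.
Qed.

Lemma CSeries_unique (a : nat -> C) (l : C) :
  is_series (K := C_AbsRing) (V := C_NormedModule) a l -> CSeries a = l.
Proof.
  intros H. apply (iota_unique (V := C_CompleteNormedModule)); [| exact H].
  intros y Hy. exact (filterlim_locally_unique (V := C_NormedModule) _ _ _ Hy H).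
Qed.

(** * Real parts of quotients of a series and its partial sums *)

(** With [w = t / p] the quotients are [1 + w] and [1 / (1 + w)], where [|w| <= k]. *)
Lemma Re_quot_ge (p t : C) (k : R) :
  0 <= k <= 1 -> p <> 0%C -> (p + t)%C <> 0%C -> Cmod t <= k * Cmod p ->
  1 - k <= Re ((p + t) / p) /\ / (1 + k) <= Re (p / (p + t)).
Proof.
  intros Hk Hp Hpt Ht. set (w := (t / p)%C).
  assert (Hw : Cmod w <= k).
  { unfold w. rewrite Cmod_div by exact Hp.
    apply Cmod_gt_0 in Hp. apply Rle_div_l; assumption. }
  assert (H1w : (1 + w)%C <> 0%C).
  { intros E. apply Hpt. unfold w in E.
    replace (p + t)%C with (p * (1 + t / p))%C by (field; exact Hp).
    rewrite E. ring. }
  replace ((p + t) / p)%C with (1 + w)%C by (unfold w; field; exact Hp).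
  replace (p / (p + t))%C with (/ (1 + w))%C.
  2:{ unfold w. field. repeat split; auto. }
  pose proof (re_le_Cmod w) as Hre. apply Rabs_le_between in Hre.
  pose proof (Cmod2_alt w) as H2. pose proof (Cmod_ge_0 w).
  apply Cmod_gt_0 in H1w. pose proof (Cmod2_alt (1 + w)%C) as H3.
  destruct w as [x y]. unfold Re, Im in *. simpl in *.
  split; [lra |].
  assert (D : 0 < (1 + x) * ((1 + x) * 1) + (0 + y) * ((0 + y) * 1)) by nra.
  match goal with |- _ <= ?u => replace u with ((1 + x) / ((1 + x) * ((1 + x) * 1) + (0 + y) * ((0 + y) * 1))) end.
  apply Rle_div_r; [exact D |]. apply Rmult_le_reg_l with (1 + k); [lra |].
  (* It remains that [|1 + w|^2 <= (1 + k)(1 + x)]. As [|w|^2 <= k^2], this follows from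
     [(k - x)(1 - k) >= 0]. *)
  rewrite <- Rmult_assoc, Rinv_r by lra. nra.
  f_equal; ring.
Qed.

(** The factor [r < 1] keeps both [f] and [p] away from [0] even in the extreme case [q = 1/3],
    where [k = 1]. *)
Lemma Re_partial_sum_quot_ge (a : nat -> C) (r q : R) (m : nat) :
  (forall n, (1 <= n)%nat -> Cmod (a n) <= r * (2 * q ^ n)) ->
  0 <= r < 1 -> 0 <= q <= / 3 ->
  let f := (1 + CSeries (fun n => a (S n)))%C in
  let p := (1 + sum_n_m (G := C_AbelianMonoid) a 1 m)%C in
  f <> 0%C /\ p <> 0%C /\
  1 - 2 * q / (1 - q) <= Re (f / p) /\ / (1 + 2 * q / (1 - q)) <= Re (p / f).
Proof.
  intros Ha Hr Hq f p. set (k := 2 * q / (1 - q)).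
  assert (Hk : 0 <= k <= 1).
  { unfold k. split; [apply Rdiv_le_0_compat; lra | apply Rle_div_l; lra]. }
  destruct (C_ex_series_geometric a r q Ha) as [l Hl]; [lra |].
  assert (Ht : forall n, Cmod (l - sum_n_m (G := C_AbelianMonoid) a 1 n) <= r * k * q ^ n)
    by (intros n; apply C_is_series_tail_le; auto; lra).
  assert (Hs := Cmod_sum_le_geometric a r q 0 m Ha ltac:(lra) ltac:(lia)).
  fold k in Hs. rewrite pow_O in Hs.
  assert (Hqm : 0 <= q ^ m <= 1).
  { split; [apply pow_le; lra |]. rewrite <- (pow1 m). apply pow_incr. lra. }
  assert (Hrk : 0 <= r * k <= r) by nra.
  assert (Hne : forall w : C, Cmod w < 1 -> 1 - Cmod w <= Cmod (1 + w) /\ (1 + w)%C <> 0%C).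
  { intros w Hw. assert (1 - Cmod w <= Cmod (1 + w)).
    { assert (E : Cmod 1 <= Cmod (1 + w) + Cmod w).
      { replace (RtoC 1) with ((1 + w) + - w)%C at 1 by ring.
        rewrite <- (Cmod_opp w). apply Cmod_triangle. }
      rewrite Cmod_1 in E. lra. }
    split; [assumption |]. apply Cmod_gt_0. lra. }
  assert (Hp := Hne (sum_n_m (G := C_AbelianMonoid) a 1 m) ltac:(nra)).
  destruct Hp as [Hp1 Hp0]. fold p in Hp1, Hp0.
  assert (Hf : f = (1 + l)%C) by (unfold f; f_equal; now apply CSeries_unique).
  assert (Hf0 : f <> 0%C).
  { rewrite Hf. apply Hne. specialize (Ht 0%nat).
    rewrite (sum_n_m_zero (G := C_AbelianMonoid)) in Ht by lia.
    replace (l - zero)%C with l in Ht by (change (l = l - 0)%C; ring).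
    rewrite pow_O in Ht. lra. }
  assert (Ef : f = (p + (l - sum_n_m (G := C_AbelianMonoid) a 1 m))%C)
    by (rewrite Hf; unfold p; ring).
  split; [exact Hf0 |]. split; [exact Hp0 |].
  rewrite Ef. apply Re_quot_ge; auto; [now rewrite <- Ef |].
  eapply Rle_trans; [apply Ht |].
  apply Rle_trans with (k * (1 - Cmod (sum_n_m (G := C_AbelianMonoid) a 1 m)));
    [| apply Rmult_le_compat_l; lra].
  (* As [k <= 1], the convex combination [q^m + k (1 - q^m)] is at most [1]. Multiplied by [k], the
     inequality gives [|t| <= k (1 - |p - 1|)]. *)
  assert (r * q ^ m <= 1 - r * k * (1 - q ^ m)) by nra.
  nra.
Qed.

(** * Bounds on the Rabotnov coefficients *)

(** Passing from [n] to [n + 1] gains a factor [s (n + 1) >= 2 s] when [n >= 1]. The base case gains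
    only [Gamma (2 s) >= s * Gamma s], whence the constant [2]. *)
Lemma Gamma_quot_le (s : R) (n : nat) : 1 <= s -> (1 <= n)%nat ->
  Gamma s / Gamma (s * (INR n + 1)) <= 2 / (2 * s) ^ n.
Proof.
  intros Hs Hn.
  assert (Hn0 := pos_INR n).
  destruct (is_RInt_gen_Gamma (s * (INR n + 1))) as [_ HG]; [nra |].
  assert (Hpow : 0 < (2 * s) ^ n) by (apply pow_lt; lra).
  enough (Gamma s * (2 * s) ^ n <= 2 * Gamma (s * (INR n + 1))).
  { apply Rle_div_l; [exact HG |].
    replace (2 / (2 * s) ^ n * Gamma (s * (INR n + 1))) with
      (2 * Gamma (s * (INR n + 1)) / (2 * s) ^ n) by (field; lra).
    apply Rle_div_r; assumption. }
  clear Hpow HG Hn0. induction Hn as [| n Hn IH].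
  - replace (INR 1) with 1 by reflexivity. rewrite pow_1.
    assert (Gamma (s + 1) <= Gamma (s * (1 + 1))) by (apply Gamma_incr; lra).
    rewrite Gamma_succ in H by exact Hs. lra.
  - assert (Hn1 : 1 <= INR n) by (apply (le_INR 1); exact Hn).
    set (x := s * (INR n + 1)) in *.
    assert (Hx : 2 * s <= x) by (unfold x; nra).
    assert (H : Gamma (x + 1) <= Gamma (s * (INR (S n) + 1))).
    { apply Gamma_incr. rewrite S_INR. unfold x in *. nra. }
    rewrite Gamma_succ in H by lra.
    destruct (is_RInt_gen_Gamma x) as [_ HG]; [lra |].
    assert (2 * s * Gamma x <= x * Gamma x) by (apply Rmult_le_compat_r; lra).
    change ((2 * s) ^ S n) with (2 * s * (2 * s) ^ n).
    apply (Rmult_le_compat_l (2 * s)) in IH; [| lra]. nra.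
Qed.

(** Of [|z|^n] one factor [|z|] is retained: it plays the part of [r], whose strict bound [r < 1]
    gives nonvanishing. *)
Lemma Cmod_Rabotnov_term_le (alpha gamma : R) (beta z : C) (n : nat) :
  1 <= gamma + alpha -> Cmod z <= 1 -> (1 <= n)%nat ->
  Cmod (Rabotnov_coeff alpha gamma beta n * Cpow z n)
    <= Cmod z * (2 * (Cmod beta / (2 * (gamma + alpha))) ^ n).
Proof.
  intros Hs Hz Hn. unfold Rabotnov_coeff. set (s := gamma + alpha) in *.
  rewrite !Cmod_mult, !Cmod_pow, Cmod_R.
  assert (Hn0 := pos_INR n).
  destruct (is_RInt_gen_Gamma s) as [_ H1]; [lra |].
  destruct (is_RInt_gen_Gamma (s * (INR n + 1))) as [_ H2]; [nra |].
  pose proof (Gamma_quot_le s n Hs Hn) as HG.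
  rewrite Rabs_pos_eq by (apply Rlt_le, Rdiv_lt_0_compat; assumption).
  pose proof (Cmod_ge_0 z). pose proof (Cmod_ge_0 beta).
  assert (Hzn : Cmod z ^ n <= Cmod z).
  { destruct n as [| n]; [lia |]. simpl.
    assert (Cmod z ^ n <= 1) by (rewrite <- (pow1 n); apply pow_incr; lra).
    assert (0 <= Cmod z ^ n) by (apply pow_le; lra). nra. }
  assert (Hb : 0 <= Cmod beta ^ n) by (apply pow_le; lra).
  rewrite (Rmult_comm (Cmod z)).
  apply Rmult_le_compat; [| apply pow_le; lra | | exact Hzn].
  - apply Rmult_le_pos; [exact Hb |]. apply Rlt_le, Rdiv_lt_0_compat; assumption.
  - replace (2 * (Cmod beta / (2 * s)) ^ n) with (Cmod beta ^ n * (2 / (2 * s) ^ n)).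
    + apply Rmult_le_compat_l; assumption.
    + unfold Rdiv. rewrite (Rpow_mult_distr (Cmod beta)), pow_inv. ring.
Qed.

(** * Cancelling the common factor [z], and the final estimates *)

Lemma Rabotnov_partial_factor (alpha gamma : R) (beta z : C) (m : nat) :
  Rabotnov_partial alpha gamma beta m z
  = (z * Rabotnov_partial_red alpha gamma beta m z)%C.
Proof.
  unfold Rabotnov_partial, Rabotnov_partial_red.
  rewrite Cmult_plus_distr_l, Cmult_1_r. f_equal.
  etransitivity; [| apply (sum_n_m_mult_l (K := C_Ring))].
  apply (sum_n_m_ext (G := C_AbelianMonoid)). intros n. simpl.
  rewrite Cpow_add_r. change mult with Cmult. simpl. ring.
Qed.

(** [CSeries] is determined only on convergent series, so [z] is moved through the sum by uniqueness
    of the limit [l]. *)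
Lemma Rabotnov_factor (alpha gamma : R) (beta z : C) (l : C) :
  is_series (K := C_AbsRing) (V := C_NormedModule)
    (fun n => Rabotnov_coeff alpha gamma beta (S n) * Cpow z (S n))%C l ->
  Rabotnov alpha gamma beta z = (z * Rabotnov_red alpha gamma beta z)%C.
Proof.
  intros Hl. unfold Rabotnov, Rabotnov_red.
  rewrite Cmult_plus_distr_l, Cmult_1_r. f_equal.
  rewrite (CSeries_unique _ _ Hl). apply CSeries_unique.
  eapply is_series_ext; [| exact (is_series_scal (V := C_NormedModule) z _ _ Hl)].
  intros n. simpl. rewrite Cpow_add_r. change scal with Cmult. simpl. ring.
Qed.

Theorem theorem1p4 (alpha gamma : R) (beta : C)
  (halpha : (0 <= alpha)%R) (hgamma : (1 <= gamma)%R)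
  (hbeta : (2 * (gamma + alpha) >= 3 * Cmod beta)%R)
  (m : nat) (z : C) (hz : (Cmod z < 1)%R) :
  (Re (Rabotnov_quot alpha gamma beta m z)
     >= (2 * (gamma + alpha) - 3 * Cmod beta) / (2 * (gamma + alpha) - Cmod beta))%R
  /\
  (Re (Rabotnov_quot_inv alpha gamma beta m z)
     >= (2 * (gamma + alpha) - Cmod beta) / (2 * (gamma + alpha) + Cmod beta))%R.
Proof.
  pose proof (Cmod_ge_0 beta) as Hb. pose proof (Cmod_ge_0 z) as Hz.
  set (q := Cmod beta / (2 * (gamma + alpha))).
  assert (Hq : 0 <= q <= / 3).
  { unfold q. split; [apply Rdiv_le_0_compat; lra | apply Rle_div_l; lra]. }
  set (a := fun n => (Rabotnov_coeff alpha gamma beta n * Cpow z n)%C).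
  assert (Ha : forall n, (1 <= n)%nat -> Cmod (a n) <= Cmod z * (2 * q ^ n))
    by (intros n Hn; apply Cmod_Rabotnov_term_le; [lra | lra | exact Hn]).
  destruct (C_ex_series_geometric a (Cmod z) q Ha) as [l Hl]; [lra |].
  destruct (Re_partial_sum_quot_ge a (Cmod z) q m Ha) as (Hf & Hp & H1 & H2);
    [lra | exact Hq |].
  change (1 + CSeries (fun n => a (S n)))%C with (Rabotnov_red alpha gamma beta z) in *.
  change (1 + sum_n_m (G := C_AbelianMonoid) a 1 m)%C
    with (Rabotnov_partial_red alpha gamma beta m z) in *.
  (* The bounds are [(1 - 3q)/(1 - q)] and [(1 - q)/(1 + q)], each expanded by
     [2 (gamma + alpha)]. *)
  replace (1 - 2 * q / (1 - q)) with
    ((2 * (gamma + alpha) - 3 * Cmod beta) / (2 * (gamma + alpha) - Cmod beta)) in H1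
    by (unfold q; field; lra).
  replace (/ (1 + 2 * q / (1 - q))) with
    ((2 * (gamma + alpha) - Cmod beta) / (2 * (gamma + alpha) + Cmod beta)) in H2
    by (unfold q; field; lra).
  unfold Rabotnov_quot, Rabotnov_quot_inv.
  (* At [z = 0] the quotients are by definition the reduced ones; elsewhere [z] cancels, [f] and [p]
     being nonzero. *)
  destruct (Ceq_dec z 0) as [_ | Hz0]; [split; apply Rle_ge; assumption |].
  rewrite (Rabotnov_factor _ _ _ _ l Hl), Rabotnov_partial_factor.
  set (f := Rabotnov_red _ _ _ _) in *. set (p := Rabotnov_partial_red _ _ _ _ _) in *.
  replace (z * f / (z * p))%C with (f / p)%C by (field; auto).
  replace (z * p / (z * f))%C with (p / f)%C by (field; auto).
  split; apply Rle_ge; assumption.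
Qed.
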